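(* Let $\mathcal{E}$ be an elementary topos. Then the atoms of the lattice of subtoposes of $\mathcal{E}$ are exactly the two-valued Boolean subtoposes of $\mathcal{E}$.
   Context: A subtopos of $\mathcal{E}$ is a geometric inclusion $\mathbf{sh}_j(\mathcal{E})\hookrightarrow\mathcal{E}$ for a local operator $j$ on $\mathcal{E}$; subtoposes are ordered by inclusion. The atoms are the non-trivial subtoposes which have no proper non-trivial subtoposes, where a topos is trivial (degenerate) if $0\cong 1$ in it. A topos is two-valued if its terminal object has exactly two subobjects, and Boolean if all its subobject lattices are Boolean algebras. *)

(* Defs.v *)
Set Implicit Arguments.
Unset Strict Implicit.
Unset Printing Implicit Defensive.

Declare Scope topos_scope.
Delimit Scope topos_scope with topos.
Open Scope topos_scope.

(** * Categories *)

Record category := Category {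
  ob :> Type;
  hom : ob -> ob -> Type;
  id_arr : forall X, hom X X;
  comp : forall X Y Z, hom Y Z -> hom X Y -> hom X Z;
  comp_id_l : forall X Y (f : hom X Y), comp (id_arr Y) f = f;
  comp_id_r : forall X Y (f : hom X Y), comp f (id_arr X) = f;
  comp_assoc : forall X Y Z W (h : hom Z W) (g : hom Y Z) (f : hom X Y),
    comp h (comp g f) = comp (comp h g) f
}.

Arguments hom {c} X Y.
Arguments id_arr {c} X.
Arguments comp {c X Y Z} g f.

Notation "g ∘ f" := (comp g f) (at level 40, left associativity) : topos_scope.

Section CategoryNotions.
Variable C : category.

Definition mono (X Y : C) (m : hom X Y) : Prop :=
  forall (W : C) (f g : hom W X), m ∘ f = m ∘ g -> f = g.

Definition isomorphic (X Y : C) : Prop :=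
  exists (f : hom X Y) (g : hom Y X), g ∘ f = id_arr X /\ f ∘ g = id_arr Y.

Definition is_terminal (T : C) : Prop :=
  forall X : C, exists f : hom X T, forall g : hom X T, g = f.

Definition is_initial (I : C) : Prop :=
  forall X : C, exists f : hom I X, forall g : hom I X, g = f.

Definition is_pullback (P A B D : C)
    (p : hom P A) (q : hom P B) (f : hom A D) (g : hom B D) : Prop :=
  f ∘ p = g ∘ q /\
  forall (W : C) (u : hom W A) (v : hom W B), f ∘ u = g ∘ v ->
    exists! w : hom W P, p ∘ w = u /\ q ∘ w = v.

Record subobject (X : C) := Subobject {
  sub_dom : C;
  sub_arr : hom sub_dom X;
  sub_mono : mono sub_arr
}.

Definition sub_le (X : C) (A B : subobject X) : Prop :=
  exists h : hom (sub_dom A) (sub_dom B), sub_arr B ∘ h = sub_arr A.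

End CategoryNotions.

Definition full_subcategory (C : category) (P : C -> Prop) : category :=
  @Category {X : C | P X}
    (fun X Y => hom (proj1_sig X) (proj1_sig Y))
    (fun X => id_arr (proj1_sig X))
    (fun X Y Z g f => g ∘ f)
    (fun X Y f => comp_id_l f)
    (fun X Y f => comp_id_r f)
    (fun X Y Z W h g f => comp_assoc h g f).

(** * Boolean algebras *)

Definition ord_equiv (T : Type) (le : T -> T -> Prop) (x y : T) : Prop :=
  le x y /\ le y x.

(* Subobjects are represented by monomorphisms, which are only preordered, so
   the laws below are those of a complemented distributive lattice up to
   [ord_equiv]: the poset reflection of [le] is a Boolean algebra. *)
Definition is_boolean_algebra (T : Type) (le : T -> T -> Prop) : Prop :=
  (forall x, le x x) /\
  (forall x y z, le x y -> le y z -> le x z) /\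
  exists (meet join : T -> T -> T) (top bot : T) (compl : T -> T),
    (forall x, le x top) /\
    (forall x, le bot x) /\
    (forall x y z, le z (meet x y) <-> le z x /\ le z y) /\
    (forall x y z, le (join x y) z <-> le x z /\ le y z) /\
    (forall x y z, ord_equiv le (meet x (join y z))
                                (join (meet x y) (meet x z))) /\
    (forall x, ord_equiv le (meet x (compl x)) bot) /\
    (forall x, ord_equiv le (join x (compl x)) top).

(** * Triviality, two-valuedness and Booleanness *)

Definition trivial (C : category) : Prop :=
  exists I T : C, is_initial I /\ is_terminal T /\ isomorphic I T.

Definition two_valued (C : category) : Prop :=
  exists T : C, is_terminal T /\
  exists U V : subobject T,
    ~ ord_equiv (@sub_le C T) U V /\
    forall W : subobject T,
      ord_equiv (@sub_le C T) W U \/ ord_equiv (@sub_le C T) W V.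

Definition boolean (C : category) : Prop :=
  forall X : C, is_boolean_algebra (@sub_le C X).

(** * Elementary toposes *)

(* A category with finite limits (a terminal object, binary products and
   equalizers), exponentials and a subobject classifier. *)
Record topos := Topos {
  topos_cat :> category;

  one : topos_cat;
  bang : forall X : topos_cat, hom X one;
  bang_unique : forall (X : topos_cat) (f : hom X one), f = bang X;

  bprod : topos_cat -> topos_cat -> topos_cat;
  pr1 : forall X Y : topos_cat, hom (bprod X Y) X;
  pr2 : forall X Y : topos_cat, hom (bprod X Y) Y;
  pairing : forall Z X Y : topos_cat, hom Z X -> hom Z Y -> hom Z (bprod X Y);
  pairing_pr1 : forall (Z X Y : topos_cat) (f : hom Z X) (g : hom Z Y),
    pr1 X Y ∘ pairing f g = f;
  pairing_pr2 : forall (Z X Y : topos_cat) (f : hom Z X) (g : hom Z Y),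
    pr2 X Y ∘ pairing f g = g;
  pairing_unique : forall (Z X Y : topos_cat) (h : hom Z (bprod X Y)),
    h = pairing (pr1 X Y ∘ h) (pr2 X Y ∘ h);

  eqz : forall (X Y : topos_cat) (f g : hom X Y), topos_cat;
  eqz_arr : forall (X Y : topos_cat) (f g : hom X Y), hom (eqz f g) X;
  eqz_comm : forall (X Y : topos_cat) (f g : hom X Y),
    f ∘ eqz_arr f g = g ∘ eqz_arr f g;
  eqz_universal : forall (X Y : topos_cat) (f g : hom X Y)
      (W : topos_cat) (u : hom W X), f ∘ u = g ∘ u ->
    exists! w : hom W (eqz f g), eqz_arr f g ∘ w = u;

  expo : topos_cat -> topos_cat -> topos_cat;
  eval : forall X Y : topos_cat, hom (bprod (expo X Y) X) Y;
  eval_universal : forall (X Y Z : topos_cat) (f : hom (bprod Z X) Y),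
    exists! g : hom Z (expo X Y),
      eval X Y ∘ pairing (g ∘ pr1 Z X) (pr2 Z X) = f;

  Omega : topos_cat;
  truth : hom one Omega;
  chi : forall (A X : topos_cat) (m : hom A X), mono m -> hom X Omega;
  chi_pullback : forall (A X : topos_cat) (m : hom A X) (mm : mono m),
    is_pullback m (bang A) (chi mm) truth;
  chi_unique : forall (A X : topos_cat) (m : hom A X) (mm : mono m)
      (c : hom X Omega), is_pullback m (bang A) c truth -> c = chi mm
}.

Arguments one {t}.
Arguments bang {t} X.
Arguments bprod {t} X Y.
Arguments pr1 {t} X Y.
Arguments pr2 {t} X Y.
Arguments pairing {t Z X Y} f g.
Arguments Omega {t}.
Arguments truth {t}.
Arguments chi {t A X m} mm.

Section LocalOperators.
Variable E : topos.

Lemma mono_from_one (X : E) (m : hom one X) : mono m.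
Proof.
intros W f g _; rewrite (bang_unique f); symmetry; apply bang_unique.
Qed.

(* Internal conjunction Omega x Omega -> Omega. *)
Definition Omega_meet : hom (bprod Omega Omega) (Omega : E) :=
  chi (@mono_from_one _ (pairing truth truth)).

(* Lawvere-Tierney topologies. *)
Record local_operator := LocalOperator {
  lop : hom (Omega : E) Omega;
  lop_truth : lop ∘ truth = truth;
  lop_idem : lop ∘ lop = lop;
  lop_meet : lop ∘ Omega_meet =
    Omega_meet ∘ pairing (lop ∘ pr1 Omega Omega) (lop ∘ pr2 Omega Omega)
}.

(* The j-closure of m is classified by j ∘ chi_m; m is dense when its closure
   is the maximal subobject. *)
Definition dense (j : local_operator) (A X : E) (m : hom A X) (mm : mono m) :
    Prop :=
  lop j ∘ chi mm = truth ∘ bang X.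

Definition is_sheaf (j : local_operator) (F : E) : Prop :=
  forall (A X : E) (m : hom A X) (mm : mono m), dense j mm ->
  forall f : hom A F, exists! g : hom X F, g ∘ m = f.

Definition sh (j : local_operator) : category :=
  full_subcategory (is_sheaf j).

(* Subtoposes are represented by local operators.  The subcategories of sheaves
   are full and replete, so sh_j -> E factors through sh_k -> E exactly when
   every j-sheaf is a k-sheaf. *)
Definition subtopos_le (j k : local_operator) : Prop :=
  forall F : E, is_sheaf j F -> is_sheaf k F.

Definition proper_subtopos (j k : local_operator) : Prop :=
  subtopos_le j k /\ ~ subtopos_le k j.

Definition is_atom (j : local_operator) : Prop :=
  ~ trivial (sh j) /\
  ~ exists k : local_operator, proper_subtopos k j /\ ~ trivial (sh k).

End LocalOperators.

(* Main.v *)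
From Stdlib Require Import Classical ssreflect.
Require Import Defs.

Set Implicit Arguments.
Unset Strict Implicit.
Unset Printing Implicit Defensive.

(** For a closed truth value [u : 1 -> Omega] of a local operator [j], the
    operator [p |-> ((p => u) => u)] is a local operator [k_u] above [j] that
    fixes [u]; its sheaf subtopos is trivial only if [u] is true.  If [j] is an
    atom, then [j = k_u] for every closed [u] other than true.  Taking
    [u = j(false)] gives Booleanness of the sheaf topos, and comparing [k_u]
    with [k_v] shows that there is only one such [u].  Conversely, Booleanness
    says that [j p = ((p => j(false)) => j(false))], so an operator [k] above
    [j] with [k(false) = j(false)] coincides with [j]; two-valuedness leaves
    only [k(false)] true as the alternative, and then the sheaf topos of [k] is
    trivial. *)

(** * The Kripke-Joyal reading of truth values *)

Section Truth.
Variable E : topos.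

Definition holds (W : E) (p : hom W Omega) : Prop := p = truth ∘ bang W.

(** Quantifying over all generalized elements of [W] makes this the inclusion of the classified
    subobjects, not a comparison at the single stage [W]. *)
Definition entails (W : E) (p q : hom W Omega) : Prop :=
  forall (V : E) (x : hom V W), holds (p ∘ x) -> holds (q ∘ x).

Lemma bang_comp (V W : E) (x : hom V W) : bang W ∘ x = bang V.
Proof. exact: bang_unique. Qed.

Lemma global_comp (X V W : E) (u : hom one X) (x : hom V W) :
  u ∘ bang W ∘ x = u ∘ bang V.
Proof. by rewrite -comp_assoc bang_comp. Qed.

Lemma bang_one : bang (one : E) = id_arr one.
Proof. by rewrite -(bang_unique (id_arr one)). Qed.

Lemma global_one (X : E) (u : hom one X) : u ∘ bang one = u.
Proof. by rewrite bang_one comp_id_r. Qed.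

Lemma pairing_comp (V Z X Y : E) (f : hom Z X) (g : hom Z Y) (h : hom V Z) :
  pairing f g ∘ h = pairing (f ∘ h) (g ∘ h).
Proof.
by rewrite [LHS]pairing_unique !comp_assoc pairing_pr1 pairing_pr2.
Qed.

Lemma holds_comp (V W : E) (p : hom W Omega) (x : hom V W) :
  holds p -> holds (p ∘ x).
Proof. by move=> ->; rewrite /holds global_comp. Qed.

Lemma holds_true (W : E) : holds (truth ∘ bang W).
Proof. by []. Qed.

Lemma eqz_mono (X Y : E) (f g : hom X Y) : mono (eqz_arr f g).
Proof.
move=> W a b eab.
have fa : f ∘ (eqz_arr f g ∘ a) = g ∘ (eqz_arr f g ∘ a).
  by rewrite !comp_assoc eqz_comm.
have [w [_ uw]] := eqz_universal fa.
by rewrite -(uw a) // -(uw b).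
Qed.

Lemma eqz_factor (X Y W : E) (f g : hom X Y) (u : hom W X) :
  f ∘ u = g ∘ u <-> exists w, eqz_arr f g ∘ w = u.
Proof.
split=> [/eqz_universal [w [wu _]]|[w <-]]; first by exists w.
by rewrite !comp_assoc eqz_comm.
Qed.

Lemma holds_chi (A X W : E) (m : hom A X) (mm : mono m) (x : hom W X) :
  holds (chi mm ∘ x) <-> exists w, m ∘ w = x.
Proof.
have [sq univ] := chi_pullback mm; split.
  by move=> /univ [w [[wx _] _]]; exists w.
by move=> [w <-]; rewrite comp_assoc sq; apply/holds_comp/holds_true.
Qed.

Definition compr (X : E) (p : hom X Omega) := eqz p (truth ∘ bang X).

Definition compr_arr (X : E) (p : hom X Omega) : hom (compr p) X :=
  eqz_arr p (truth ∘ bang X).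

Lemma compr_mono (X : E) (p : hom X Omega) : mono (compr_arr p).
Proof. exact: eqz_mono. Qed.

Lemma compr_factor (X W : E) (p : hom X Omega) (x : hom W X) :
  holds (p ∘ x) <-> exists w, compr_arr p ∘ w = x.
Proof. by rewrite -eqz_factor global_comp. Qed.

Lemma holds_compr (X : E) (p : hom X Omega) : holds (p ∘ compr_arr p).
Proof. by apply/compr_factor; exists (id_arr _); rewrite comp_id_r. Qed.

Lemma chi_characterized (A X : E) (m : hom A X) (mm : mono m)
    (p : hom X Omega) :
  (forall W (x : hom W X), holds (p ∘ x) <-> exists w, m ∘ w = x) ->
  p = chi mm.
Proof.
move=> pE; apply: chi_unique; split.
  suff -> : p ∘ m = truth ∘ bang A by [].
  by apply/pE; exists (id_arr A); rewrite comp_id_r.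
move=> W u v; rewrite (bang_unique v) => /pE [w wu].
exists w; split; first by split=> //; apply: bang_unique.
by move=> w' [w'u _]; apply: mm; rewrite wu w'u.
Qed.

(** Extensionality of truth values: both maps classify the comprehension of [p]. *)
Lemma entails_antisym (X : E) (p q : hom X Omega) :
  entails p q -> entails q p -> p = q.
Proof.
move=> pq qp; rewrite
  (chi_characterized (@compr_mono _ p) (fun W => @compr_factor _ W p)).
symmetry; apply: chi_characterized => W x.
by rewrite -compr_factor; split; [apply: qp | apply: pq].
Qed.

Lemma chi_compr (X : E) (p : hom X Omega) (mm : mono (compr_arr p)) :
  chi mm = p.
Proof. by symmetry; apply: chi_characterized => W x; apply: compr_factor. Qed.

Lemma entails_refl (X : E) (p : hom X Omega) : entails p p.
Proof. by []. Qed.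

#[local] Hint Resolve entails_refl : core.

Lemma entails_trans (X : E) (q p r : hom X Omega) :
  entails p q -> entails q r -> entails p r.
Proof. by move=> pq qr V x /pq /qr. Qed.

Lemma entails_holds (X : E) (p q : hom X Omega) :
  entails p q -> holds p -> holds q.
Proof. by move=> /(_ X (id_arr X)); rewrite !comp_id_r. Qed.

Lemma entails_comp (V X : E) (p q : hom X Omega) (x : hom V X) :
  entails p q -> entails (p ∘ x) (q ∘ x).
Proof. by move=> pq W y; rewrite -!comp_assoc; apply: pq. Qed.

(** * Internal conjunction, implication and falsity *)

Definition meet (W : E) (p q : hom W Omega) : hom W Omega :=
  Omega_meet E ∘ pairing p q.

Lemma meet_comp (V W : E) (p q : hom W Omega) (x : hom V W) :
  meet p q ∘ x = meet (p ∘ x) (q ∘ x).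
Proof. by rewrite /meet -comp_assoc pairing_comp. Qed.

Lemma holds_meet (W : E) (p q : hom W Omega) :
  holds (meet p q) <-> holds p /\ holds q.
Proof.
rewrite /meet /Omega_meet holds_chi; split.
  move=> [w]; rewrite pairing_comp (bang_unique w) => e; split.
    by rewrite -(pairing_pr1 p q) -e pairing_pr1.
  by rewrite -(pairing_pr2 p q) -e pairing_pr2.
by move=> [-> ->]; exists (bang W); rewrite pairing_comp.
Qed.

Lemma entails_meet (W : E) (p q r : hom W Omega) :
  entails r (meet p q) <-> entails r p /\ entails r q.
Proof.
split.
  move=> h; split=> V x /h; rewrite meet_comp holds_meet; by case.
move=> [rp rq] V x rx; rewrite meet_comp holds_meet.
by split; [apply: rp | apply: rq].
Qed.

Lemma meetl (W : E) (p q : hom W Omega) : entails (meet p q) p.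
Proof. by case: (proj1 (entails_meet p q _) (@entails_refl _ _)). Qed.

Lemma meetr (W : E) (p q : hom W Omega) : entails (meet p q) q.
Proof. by case: (proj1 (entails_meet p q _) (@entails_refl _ _)). Qed.

(** Implication classifies the internal order on [Omega], cut out as the pairs whose meet equals the
    first component. *)
Definition Omega_imp : hom (bprod Omega Omega) (Omega : E) :=
  chi (@eqz_mono _ _ (Omega_meet E) (pr1 Omega Omega)).

Definition imp (W : E) (p q : hom W Omega) : hom W Omega :=
  Omega_imp ∘ pairing p q.

Lemma imp_comp (V W : E) (p q : hom W Omega) (x : hom V W) :
  imp p q ∘ x = imp (p ∘ x) (q ∘ x).
Proof. by rewrite /imp -comp_assoc pairing_comp. Qed.

Lemma holds_imp (W : E) (p q : hom W Omega) :
  holds (imp p q) <-> entails p q.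
Proof.
rewrite /imp /Omega_imp holds_chi -eqz_factor pairing_pr1.
rewrite -/(meet p q); split=> [e|pq].
  by rewrite -e; apply: meetr.
by apply: entails_antisym; [apply: meetl | apply/entails_meet].
Qed.

Lemma entails_imp (W : E) (p q r : hom W Omega) :
  entails r (imp p q) <-> entails (meet r p) q.
Proof.
split=> h V x.
  rewrite meet_comp holds_meet => -[/h].
  by rewrite imp_comp => /holds_imp /entails_holds; apply.
move=> rx; rewrite imp_comp; apply/holds_imp => U y py.
rewrite -comp_assoc; apply: h; rewrite meet_comp holds_meet !comp_assoc.
by split=> //; apply: holds_comp.
Qed.

(* Falsity is the truth value of "every truth value is true". *)
Lemma falsity_exists : exists bot : hom one (Omega : E),
  forall (W : E) (p : hom W Omega), entails (bot ∘ bang W) p.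
Proof.
(* [g1] and [g2] name the identity and the constantly true map on [Omega]; falsity is the truth
   value of their equality. *)
have [g1 [e1 _]] := eval_universal (pr2 (one : E) Omega).
have [g2 [e2 _]] := eval_universal (truth ∘ bang (bprod (one : E) Omega)).
exists (chi (@eqz_mono _ _ g1 g2)) => W p V x.
rewrite global_comp holds_chi -eqz_factor => e12.
have ev (g : hom one (expo (Omega : E) Omega)) f :
    eval Omega Omega ∘ pairing (g ∘ pr1 one Omega) (pr2 one Omega) = f ->
    eval Omega Omega ∘ pairing (g ∘ bang V) (p ∘ x) =
    f ∘ pairing (bang V) (p ∘ x).
  move=> <-; rewrite -[RHS]comp_assoc pairing_comp.
  by rewrite -[g ∘ _ ∘ pairing _ _]comp_assoc pairing_pr1 pairing_pr2.
have := ev _ _ e1; rewrite e12 (ev _ _ e2) global_comp pairing_pr2.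
by move=> <-.
Qed.

End Truth.

(** * Local operators and their sheaves *)

Section Operators.
Variable E : topos.
Implicit Types j k : local_operator E.

#[local] Hint Resolve entails_refl : core.

Definition closed j (W : E) (p : hom W Omega) : Prop := lop j ∘ p = p.

Definition lop_le j k : Prop :=
  forall (W : E) (p : hom W Omega), entails (lop j ∘ p) (lop k ∘ p).

Lemma lop_meet_app j (W : E) (p q : hom W Omega) :
  lop j ∘ meet p q = meet (lop j ∘ p) (lop j ∘ q).
Proof.
rewrite /meet comp_assoc lop_meet -comp_assoc pairing_comp.
by rewrite -!comp_assoc pairing_pr1 pairing_pr2.
Qed.

Lemma lop_holds j (W : E) (p : hom W Omega) : holds p -> holds (lop j ∘ p).
Proof. by move=> ->; rewrite /holds comp_assoc lop_truth. Qed.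

Lemma lop_unit j (W : E) (p : hom W Omega) : entails p (lop j ∘ p).
Proof. by move=> V x px; rewrite -comp_assoc; apply: lop_holds. Qed.

Lemma lop_closed j (W : E) (p : hom W Omega) : closed j (lop j ∘ p).
Proof. by rewrite /closed comp_assoc lop_idem. Qed.

(** Entailment is an equation between meets, and [j] preserves meets. *)
Lemma lop_mono j (W : E) (p q : hom W Omega) :
  entails p q -> entails (lop j ∘ p) (lop j ∘ q).
Proof.
move=> pq; have <- : meet p q = p.
  by apply: entails_antisym; [apply: meetl | apply/entails_meet].
by rewrite lop_meet_app; apply: meetr.
Qed.

Lemma closed_comp j (V W : E) (p : hom W Omega) (x : hom V W) :
  closed j p -> closed j (p ∘ x).
Proof. by rewrite /closed comp_assoc => ->. Qed.

Lemma closed_entails j (W : E) (p q : hom W Omega) :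
  closed j q -> entails p q -> entails (lop j ∘ p) q.
Proof. by move=> <- /(@lop_mono j); rewrite !comp_assoc lop_idem. Qed.

Lemma closed_true j (W : E) : closed j (truth ∘ bang W).
Proof. by rewrite /closed comp_assoc lop_truth. Qed.

Lemma closed_meet j (W : E) (p q : hom W Omega) :
  closed j p -> closed j q -> closed j (meet p q).
Proof. by rewrite /closed lop_meet_app => -> ->. Qed.

(** Modus ponens survives closure: since [j] preserves meets, the closure of [imp p q] together with
    [p] entails the closure of [q], which is [q]. *)
Lemma closed_imp j (W : E) (p q : hom W Omega) :
  closed j q -> closed j (imp p q).
Proof.
move=> cq; apply: entails_antisym; last exact: lop_unit.
apply/entails_imp/(entails_trans (q := lop j ∘ meet (imp p q) p)).
  rewrite lop_meet_app; apply/entails_meet; split; first exact: meetl.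
  exact: entails_trans (@meetr _ _ _ _) (@lop_unit _ _ _).
by apply: closed_entails => //; apply/entails_imp.
Qed.

Lemma closed_above j k (W : E) (p : hom W Omega) :
  lop_le j k -> closed k p -> closed j p.
Proof.
move=> jk cp; apply: entails_antisym; last exact: lop_unit.
by rewrite -{2}cp; apply: jk.
Qed.

Lemma dense_holds j (A X : E) (m : hom A X) (mm : mono m) :
  dense j mm <-> holds (lop j ∘ chi mm).
Proof. by []. Qed.

(** A closed predicate that contains [m] contains its closure, which is all of [X]. *)
Lemma dense_closed_holds j (A X : E) (m : hom A X) (mm : mono m)
    (p : hom X Omega) :
  dense j mm -> closed j p -> holds (p ∘ m) -> holds p.
Proof.
move=> dm cp pm; apply: entails_holds (dm : holds _); apply: closed_entails => //.
by move=> V x /holds_chi [w <-]; rewrite comp_assoc; apply: holds_comp.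
Qed.

Lemma sheaf_separated j (F : E) : is_sheaf j F ->
  forall (A X : E) (m : hom A X) (mm : mono m), dense j mm ->
  forall g h : hom X F, g ∘ m = h ∘ m -> g = h.
Proof.
move=> sF A X m mm dm g h gh; have [w [_ uw]] := sF _ _ _ mm dm (h ∘ m).
by rewrite -(uw g) // (uw h).
Qed.

Lemma sheaf_one j : is_sheaf j (one : E).
Proof.
move=> A X m mm _ f; exists (bang X); split.
  by rewrite bang_comp; symmetry; apply: bang_unique.
by move=> h _; symmetry; apply: bang_unique.
Qed.

Lemma sheaf_compr j (X : E) (p : hom X Omega) :
  is_sheaf j X -> closed j p -> is_sheaf j (compr p).
Proof.
move=> sX cp A Y m mm dm f.
have [g [gm _]] := sX _ _ _ mm dm (compr_arr p ∘ f).
have /compr_factor [w wg] : holds (p ∘ g).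
  apply: dense_closed_holds dm _ _; first exact: closed_comp.
  by rewrite -comp_assoc gm; apply/compr_factor; exists f.
exists w; split; first by apply: compr_mono; rewrite comp_assoc wg.
move=> w' w'm; apply: compr_mono; apply: (sheaf_separated sX dm).
by rewrite wg gm -comp_assoc w'm.
Qed.

(** The object of closed truth values, which splits the idempotent [lop j]; it is the subobject
    classifier of the sheaf topos. *)
Definition Omega_closed j : E := eqz (lop j) (id_arr Omega).

Definition Omega_closed_arr j : hom (Omega_closed j) Omega :=
  eqz_arr (lop j) (id_arr Omega).

Lemma Omega_closed_factor j (W : E) (p : hom W Omega) :
  closed j p <-> exists w, Omega_closed_arr j ∘ w = p.
Proof. by rewrite -eqz_factor comp_id_l. Qed.

Lemma closed_Omega_closed_arr j : closed j (Omega_closed_arr j).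
Proof. by apply/Omega_closed_factor; exists (id_arr _); rewrite comp_id_r. Qed.

Lemma mono_comp (A X Y : E) (m : hom A X) (n : hom X Y) :
  mono m -> mono n -> mono (n ∘ m).
Proof. by move=> mm mn W f g; rewrite -!comp_assoc => /mn /mm. Qed.

(** The implication between two closed predicates is closed, so it holds everywhere once it holds on
    a dense subobject. *)
Lemma closed_dense_eq j (A X : E) (m : hom A X) (mm : mono m)
    (p q : hom X Omega) :
  dense j mm -> closed j p -> closed j q -> p ∘ m = q ∘ m -> p = q.
Proof.
move=> dm; suff le (a b : hom X Omega) :
    closed j b -> a ∘ m = b ∘ m -> entails a b.
  by move=> cp cq e; apply: entails_antisym; apply: le.
move=> cb e; apply/holds_imp; apply: (dense_closed_holds dm).
  exact: closed_imp.
by rewrite imp_comp e; apply/holds_imp.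
Qed.

(* A closed subobject of the dense subobject extends to its closure in [X]. *)
Lemma sheaf_Omega_closed j : is_sheaf j (Omega_closed j).
Proof.
move=> A X m mm dm f; set p := Omega_closed_arr j ∘ f.
have cp : closed j p by apply: closed_comp; apply: closed_Omega_closed_arr.
have mc := mono_comp (@compr_mono _ _ p) mm.
have cm : chi mc ∘ m = p.
  apply: entails_antisym => W x.
    rewrite -comp_assoc => /holds_chi [w].
    by rewrite -comp_assoc => /mm wx; apply/compr_factor; exists w.
  move=> /compr_factor [w <-]; rewrite -comp_assoc; apply/holds_chi.
  by exists w; rewrite comp_assoc.
have [g gE] := proj1 (Omega_closed_factor _ _) (lop_closed j (chi mc)).
exists g; split.
  by apply: eqz_mono; rewrite comp_assoc gE -comp_assoc cm.
move=> h hm; apply: eqz_mono; rewrite gE.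
apply: (closed_dense_eq dm).
- exact: lop_closed.
- by apply: closed_comp; apply: closed_Omega_closed_arr.
- by rewrite -!comp_assoc cm hm.
Qed.

(* Separatedness of [Omega_closed k] with respect to [j]-dense subobjects gives
   the forward direction. *)
Lemma subtopos_leE j k : subtopos_le k j <-> lop_le j k.
Proof.
split=> [kj W p V x|jk F sF A X m mm dm]; last first.
  by apply: sF; apply: entails_holds dm; apply: jk.
rewrite -!comp_assoc; move: (p ∘ x) => {p x} q jq.
have sO := kj _ (@sheaf_Omega_closed k).
have [g gE] := proj1 (Omega_closed_factor _ _) (lop_closed k q).
have [t tE] := proj1 (Omega_closed_factor _ _) (closed_true k V).
rewrite -gE /holds -tE; congr (_ ∘ _).
(* The comprehension of [q] is [j]-dense because [lop j ∘ q] holds; on it the [k]-closed values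
   [lop k ∘ q] and truth agree. *)
have dq : dense j (@compr_mono _ _ q) by apply/dense_holds; rewrite chi_compr.
apply: (sheaf_separated sO dq); apply: eqz_mono.
rewrite !comp_assoc gE tE -!comp_assoc.
by rewrite bang_comp; apply: lop_holds; apply: holds_compr.
Qed.

(** The singleton map is the transpose of the equality predicate. If the singletons of [f] and [g]
    agree, then [f] belongs to that of [g]. *)
Lemma singleton_exists (F : E) :
  exists s : hom F (expo F Omega), mono s.
Proof.
have md : mono (pairing (id_arr F) (id_arr F)).
  move=> W f g; rewrite !pairing_comp !comp_id_l => e.
  by rewrite -(pairing_pr1 f f) e pairing_pr1.
have [s [sE _]] := eval_universal (chi md); exists s => W f g sfg.
have ev (h : hom W F) :
    eval F Omega ∘ pairing (s ∘ h) f = chi md ∘ pairing h f.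
  rewrite -sE -[RHS]comp_assoc pairing_comp.
  by rewrite -[s ∘ _ ∘ _]comp_assoc pairing_pr1 pairing_pr2.
have /holds_chi [w] : holds (chi md ∘ pairing g f).
  rewrite -ev -sfg ev; apply/holds_chi.
  by exists f; rewrite pairing_comp comp_id_l.
rewrite pairing_comp !comp_id_l => e.
by rewrite -(pairing_pr2 g f) -e pairing_pr2 -(pairing_pr1 g f) -e pairing_pr1.
Qed.

Lemma sheaf_one_terminal j :
  @is_terminal (sh j) (exist _ one (@sheaf_one j)).
Proof. by move=> X; exists (bang (proj1_sig X)) => g; apply: bang_unique. Qed.

(** A trivial sheaf topos identifies closed falsity with truth. Conversely, if every truth value has
    true closure, every monomorphism is dense, and this makes the terminal sheaf initial. *)
Lemma trivial_shE k :
  trivial (sh k) <-> forall (W : E) (p : hom W Omega), holds (lop k ∘ p).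
Proof.
have [bot botE] := falsity_exists E; split.
  move=> [[I sI] [T [Iin [Tter [f [g _]]]]]] W p.
  have [a _] := Tter (exist _ one (@sheaf_one k)).
  (* Initiality equates the two closed truth values only over [I]; this point of [I] brings the
     equation back to [one]. *)
  pose c : hom one I := g ∘ a.
  have [b' bE] := proj1 (Omega_closed_factor _ _) (lop_closed k bot).
  have [t tE] := proj1 (Omega_closed_factor _ _) (closed_true k one).
  have [z zu] := Iin (exist _ _ (@sheaf_Omega_closed k)).
  have e : b' ∘ bang I = t ∘ bang I by rewrite (zu (b' ∘ bang I)) (zu (t ∘ bang I)).
  have kb : lop k ∘ bot = truth.
    rewrite -[truth]global_one -bE -tE; congr (_ ∘ _).
    by rewrite -[b']global_one -[t]global_one -(global_comp b' c) e global_comp.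
  apply: (entails_holds (lop_mono (j := k) (botE W p))).
  by rewrite comp_assoc kb; apply: holds_true.
move=> top; pose T : sh k := exist _ one (@sheaf_one k).
exists T, T; split; last split.
- (* Every monomorphism is dense, so [F] is a retract of [Omega ^ F], which
     has a point. *)
  move=> [F sF].
  have [s ms] := singleton_exists F.
  have [r _] := sF _ _ _ ms (top _ _) (id_arr F).
  have [e _] := eval_universal (truth ∘ bang (bprod (one : E) F)).
  exists (r ∘ e) => /= h.
  (* Uniqueness: the equalizer of two points is a monomorphism, hence dense, and [F] is
     separated. *)
  apply: (sheaf_separated sF (m := eqz_arr h (r ∘ e)) (mm := @eqz_mono _ _ _ _ _)).
    exact: top.
  exact: eqz_comm.
- exact: sheaf_one_terminal.
- by exists (id_arr T), (id_arr T); rewrite comp_id_l.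
Qed.

(** * Subobjects of sheaves *)

Lemma sheaf_bprod j (X Y : E) :
  is_sheaf j X -> is_sheaf j Y -> is_sheaf j (bprod X Y).
Proof.
move=> sX sY A Z m mm dm f.
have [g [gE _]] := sX _ _ _ mm dm (pr1 X Y ∘ f).
have [h [hE _]] := sY _ _ _ mm dm (pr2 X Y ∘ f).
exists (pairing g h); split; first by rewrite pairing_comp gE hE -pairing_unique.
move=> w wm; rewrite (pairing_unique w); congr pairing.
  by apply: (sheaf_separated sX dm); rewrite gE -comp_assoc wm.
by apply: (sheaf_separated sY dm); rewrite hE -comp_assoc wm.
Qed.

Lemma sheaf_eqz j (X Y : E) (f g : hom X Y) :
  is_sheaf j X -> is_sheaf j Y -> is_sheaf j (eqz f g).
Proof.
move=> sX sY A Z m mm dm h.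
have [l [lE _]] := sX _ _ _ mm dm (eqz_arr f g ∘ h).
have /eqz_factor [w wE] : f ∘ l = g ∘ l.
  apply: (sheaf_separated sY dm).
  by rewrite -!comp_assoc lE !comp_assoc eqz_comm.
exists w; split; first by apply: eqz_mono; rewrite comp_assoc wE.
move=> w' w'm; apply: eqz_mono; apply: (sheaf_separated sX dm).
by rewrite wE lE -comp_assoc w'm.
Qed.

(* Monomorphisms of sheaves are tested on sheaves only; the kernel pair of [m]
   is a sheaf. *)
Lemma sh_mono j (X Y : sh j) (m : hom X Y) :
  mono m -> @mono E (proj1_sig X) (proj1_sig Y) m.
Proof.
case: X Y m => X sX [Y sY] /= m mm W f g fg.
pose K := eqz (m ∘ pr1 X X) (m ∘ pr2 X X).
pose i : hom K (bprod X X) := eqz_arr (m ∘ pr1 X X) (m ∘ pr2 X X).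
have sK : is_sheaf j K := sheaf_eqz (sheaf_bprod sX sX) sY.
have e : pr1 X X ∘ i = pr2 X X ∘ i.
  apply: (mm (exist _ K sK)); rewrite /= !comp_assoc; exact: eqz_comm.
have /eqz_factor [w wE] :
    m ∘ pr1 X X ∘ pairing f g = m ∘ pr2 X X ∘ pairing f g.
  by rewrite -!comp_assoc pairing_pr1 pairing_pr2.
rewrite -(pairing_pr1 f g) -wE comp_assoc -/i e -comp_assoc wE.
by rewrite pairing_pr2.
Qed.

(** * Subobjects in the sheaf topos as closed predicates *)

Definition sub_pred j (X : sh j) (A : subobject X) :
    hom (proj1_sig X) (Omega : E) :=
  chi (sh_mono (@sub_mono _ _ A)).

(** Where the closure of the predicate holds at [x], the pullback of [m] along [x] is dense. Its map
    to the sheaf [A] therefore extends and factors [x] through [m]. *)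
Lemma closed_sub_pred j (X : sh j) (A : subobject X) : closed j (sub_pred A).
Proof.
case: X A => X sX [[A sA] /= m mm].
apply: entails_antisym; last exact: lop_unit.
rewrite /sub_pred /=; move: (sh_mono _) => /= mm' V x jx.
apply/holds_chi.
have dp : dense j (@compr_mono _ _ (chi mm' ∘ x)).
  by apply/dense_holds; rewrite chi_compr comp_assoc.
have /holds_chi [r rE] : holds (chi mm' ∘ (x ∘ compr_arr (chi mm' ∘ x))).
  by rewrite comp_assoc; apply: holds_compr.
have [w [wE _]] := sA _ _ _ _ dp r; exists w.
by apply: (sheaf_separated sX dp); rewrite -comp_assoc wE.
Qed.

Lemma sub_leE j (X : sh j) (A B : subobject X) :
  sub_le A B <-> entails (sub_pred A) (sub_pred B).
Proof.
split=> [[h hE] V x /holds_chi [w wE]|h].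
  apply/holds_chi; exists ((h : hom (proj1_sig _) (proj1_sig _)) ∘ w).
  by rewrite comp_assoc -wE; congr (_ ∘ _).
have /holds_chi [w wE] : holds (sub_pred B ∘ (sub_arr A : hom (proj1_sig _) _)).
  by apply/h/holds_chi; exists (id_arr _); rewrite comp_id_r.
by exists w.
Qed.

Lemma compr_sh_mono j (X : sh j) (p : hom (proj1_sig X) (Omega : E))
    (cp : closed j p) :
  @mono (sh j) (exist _ (compr p) (sheaf_compr (proj2_sig X) cp)) X
    (compr_arr p).
Proof. by move=> W f g; apply: compr_mono. Qed.

Definition pred_sub j (X : sh j) (p : hom (proj1_sig X) (Omega : E))
    (cp : closed j p) : subobject X :=
  Subobject (@compr_sh_mono j X p cp).

Lemma sub_pred_sub j (X : sh j) (p : hom (proj1_sig X) (Omega : E))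
    (cp : closed j p) :
  sub_pred (pred_sub cp) = p.
Proof. exact: chi_compr. Qed.

(** * Double negation relative to a truth value *)

Section RelativeNegation.
Variable u : hom one (Omega : E).

Definition neg (W : E) (p : hom W Omega) : hom W Omega := imp p (u ∘ bang W).

Lemma neg_comp (V W : E) (p : hom W Omega) (x : hom V W) :
  neg p ∘ x = neg (p ∘ x).
Proof. by rewrite /neg imp_comp global_comp. Qed.

Lemma entails_neg (W : E) (p q : hom W Omega) :
  entails q (neg p) <-> entails (meet q p) (u ∘ bang W).
Proof. exact: entails_imp. Qed.

(** Both sides say that the meet of [p] and [q] lies below [u]. *)
Lemma entails_neg_sym (W : E) (p q : hom W Omega) :
  entails q (neg p) -> entails p (neg q).
Proof.
move=> /entails_neg h; apply/entails_neg; apply: entails_trans h.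
by apply/entails_meet; split; [apply: meetr | apply: meetl].
Qed.

Lemma dneg_unit (W : E) (p : hom W Omega) : entails p (neg (neg p)).
Proof. exact/entails_neg_sym/entails_refl. Qed.

Lemma neg_anti (W : E) (p q : hom W Omega) :
  entails p q -> entails (neg q) (neg p).
Proof.
move=> pq; apply: entails_neg_sym; apply: entails_trans pq _; exact: dneg_unit.
Qed.

Lemma neg_elim (W : E) (p r : hom W Omega) :
  entails r (neg p) -> entails r p -> entails r (u ∘ bang W).
Proof.
move=> rn rp; apply: (entails_trans (q := meet (neg p) p)).
  by apply/entails_meet.
exact/entails_neg/entails_refl.
Qed.

Lemma dneg_meet (W : E) (p q : hom W Omega) :
  entails (meet (neg (neg p)) (neg (neg q))) (neg (neg (meet p q))).
Proof.
apply/entails_neg; set s := meet (meet _ _) _.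
have sp : entails s (neg (neg p)).
  exact: entails_trans (@meetl _ _ _ _) (@meetl _ _ _ _).
have sq : entails s (neg (neg q)).
  exact: entails_trans (@meetl _ _ _ _) (@meetr _ _ _ _).
have sn : entails s (neg (meet p q)) by apply: meetr.
(* Given the double negations and the negated meet, assuming [p] and then [q] contradicts [sn];
   discharging [q] contradicts [sq], and discharging [p] contradicts [sp]. *)
apply: neg_elim sp _; apply/entails_neg; apply: (neg_elim (p := neg q)).
  exact: entails_trans (@meetl _ _ _ _) sq.
apply/entails_neg; apply: (neg_elim (p := meet p q)).
  exact: entails_trans (@meetl _ _ _ _) (entails_trans (@meetl _ _ _ _) sn).
apply/entails_meet; split; last exact: meetr.
exact: entails_trans (@meetl _ _ _ _) (@meetr _ _ _ _).
Qed.

Definition Omega_dneg : hom (Omega : E) Omega := neg (neg (id_arr Omega)).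

Lemma Omega_dnegE (W : E) (p : hom W Omega) : Omega_dneg ∘ p = neg (neg p).
Proof. by rewrite /Omega_dneg !neg_comp comp_id_l. Qed.

Lemma Omega_dneg_truth : Omega_dneg ∘ truth = truth.
Proof.
rewrite Omega_dnegE -[RHS]global_one.
apply: entails_holds (@dneg_unit _ _) _.
by rewrite -[truth]global_one; apply: holds_true.
Qed.

Lemma Omega_dneg_idem : Omega_dneg ∘ Omega_dneg = Omega_dneg.
Proof.
rewrite Omega_dnegE; apply: entails_antisym; last exact: dneg_unit.
by apply/neg_anti/dneg_unit.
Qed.

Lemma Omega_dneg_meet : Omega_dneg ∘ Omega_meet E =
  Omega_meet E ∘
    pairing (Omega_dneg ∘ pr1 Omega Omega) (Omega_dneg ∘ pr2 Omega Omega).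
Proof.
have -> : Omega_meet E = meet (pr1 Omega Omega) (pr2 Omega Omega).
  rewrite /meet -{1}[Omega_meet E]comp_id_r; congr (_ ∘ _).
  by rewrite [LHS]pairing_unique !comp_id_r.
rewrite meet_comp pairing_pr1 pairing_pr2 !Omega_dnegE.
apply: entails_antisym; last exact: dneg_meet.
by apply/entails_meet; split; apply/neg_anti/neg_anti; [apply: meetl | apply: meetr].
Qed.

Definition dneg_operator : local_operator E :=
  LocalOperator Omega_dneg_truth Omega_dneg_idem Omega_dneg_meet.

Lemma dneg_operatorE (W : E) (p : hom W Omega) :
  lop dneg_operator ∘ p = neg (neg p).
Proof. exact: Omega_dnegE. Qed.

Lemma dneg_fix (W : E) : neg (neg (u ∘ bang W)) = u ∘ bang W.
Proof.
apply: entails_antisym; last exact: dneg_unit.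
apply: (neg_elim (p := neg (u ∘ bang W))); first exact: entails_refl.
by apply/entails_neg; apply: meetr.
Qed.

Lemma closed_neg j (W : E) (p : hom W Omega) : closed j u -> closed j (neg p).
Proof. by move=> cu; apply/closed_imp/closed_comp. Qed.

(** For closed [u] the double negation of [p] is a closed predicate above [p], hence above its
    closure. *)
Lemma lop_le_dneg j : closed j u -> lop_le j dneg_operator.
Proof.
move=> cu W p; rewrite dneg_operatorE.
by apply: closed_entails; [apply: closed_neg | apply: dneg_unit].
Qed.

End RelativeNegation.

(** * Atoms *)

(** The double-negation subtopos lies inside that of [j], and it is not trivial because its operator
    fixes [u], which is not true. An atom leaves no room for it to be proper. *)
Lemma atom_dneg j (u : hom one (Omega : E)) :
  is_atom j -> closed j u -> ~ holds u -> lop_le (dneg_operator u) j.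
Proof.
move=> [_ noproper] cu nu; apply/subtopos_leE; apply: NNPP => njk.
apply: noproper; exists (dneg_operator u); split.
  by split=> //; apply/subtopos_leE/lop_le_dneg.
by move=> /trivial_shE /(_ _ (u ∘ bang one)); rewrite dneg_operatorE dneg_fix global_one.
Qed.

(** With [u] as the least closed truth value, the hypothesis makes every closed predicate equal to
    its double negation, so the closed predicates satisfy classical logic. *)
Lemma boolean_of_dneg j (u : hom one (Omega : E)) :
  closed j u ->
  (forall (W : E) (p : hom W Omega), closed j p -> entails (u ∘ bang W) p) ->
  lop_le (dneg_operator u) j -> boolean (sh j).
Proof.
move=> cu ubot le X; set F := proj1_sig X.
have dn (p : hom F Omega) : closed j p -> entails (neg u (neg u p)) p.
  by move=> cp; rewrite -dneg_operatorE -{2}cp; apply: le.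
(* De Morgan's law defines joins, so disjunction on [Omega] is not needed. *)
pose joinp (p q : hom F Omega) := neg u (meet (neg u p) (neg u q)).
have joinP (p q r : hom F Omega) : closed j r ->
    entails (joinp p q) r <-> entails p r /\ entails q r.
  move=> cr; split=> [h|[pr qr]].
    by split; apply: entails_trans h; apply: entails_neg_sym;
      [apply: meetl | apply: meetr].
  apply: entails_trans (dn _ cr); apply: neg_anti; apply/entails_meet.
  by split; apply: neg_anti.
pose ucl := @closed_neg u j F.
split; first by move=> A; apply/sub_leE/entails_refl.
split.
  move=> A B C /sub_leE AB /sub_leE BC; apply/sub_leE.
  exact: entails_trans AB BC.
exists (fun A B => pred_sub (closed_meet (closed_sub_pred A) (closed_sub_pred B))).
exists (fun A B => pred_sub (ucl (meet (neg u (sub_pred A)) (neg u (sub_pred B))) cu)).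
exists (pred_sub (closed_true j F)).
exists (pred_sub (closed_comp (bang F) cu)).
exists (fun A => pred_sub (ucl (sub_pred A) cu)).
split; last split; last split; last split; last split; last split.
- by move=> A; apply/sub_leE; rewrite sub_pred_sub => V x _; apply/holds_comp/holds_true.
- by move=> A; apply/sub_leE; rewrite sub_pred_sub; apply/ubot/closed_sub_pred.
- by move=> A B C; rewrite !sub_leE sub_pred_sub; apply: entails_meet.
- by move=> A B C; rewrite !sub_leE sub_pred_sub; apply/joinP/closed_sub_pred.
- move=> A B C; rewrite /ord_equiv !sub_leE !sub_pred_sub.
  have := closed_sub_pred A; have := closed_sub_pred B; have := closed_sub_pred C.
  move: (sub_pred A) (sub_pred B) (sub_pred C) => a b c cc cb ca.
  rewrite -/(joinp b c) -/(joinp (meet a b) (meet a c)).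
  set d := joinp (meet a b) (meet a c).
  have cd : closed j d by apply: ucl.
  have [abd acd] := proj1 (joinP _ _ _ cd) (@entails_refl _ _ d).
  have sw (p q r : hom F Omega) : entails (meet p q) r -> entails (meet q p) r.
    apply: entails_trans; apply/entails_meet.
    by split; [apply: meetr | apply: meetl].
  split.
    (* Moving [a] to the right gives the closed bound [imp a d], to which the universal property of
       joins applies. *)
    apply/sw/(entails_imp _ d).
    apply/(joinP _ _ _ (closed_imp a cd)).
    by split; apply/entails_imp/sw.
  have cj : closed j (joinp b c) by apply: ucl.
  have [bj cj'] := proj1 (joinP _ _ _ cj) (@entails_refl _ _ (joinp b c)).
  apply/(joinP _ _ _ (closed_meet ca cj)).
  by split; apply/entails_meet; split; first [apply: meetl |
    apply: entails_trans bj; apply: meetr | apply: entails_trans cj'; apply: meetr].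
- move=> A; rewrite /ord_equiv !sub_leE !sub_pred_sub; split.
    apply: (neg_elim (p := sub_pred A)); [apply: meetr | apply: meetl].
  by apply: ubot; apply: closed_meet; [apply: closed_sub_pred | apply: ucl].
- move=> A; rewrite /ord_equiv !sub_leE !sub_pred_sub; split.
    by move=> V x _; apply/holds_comp/holds_true.
  apply/entails_neg; apply: (neg_elim (p := neg u (sub_pred A))).
    exact: entails_trans (@meetr _ _ _ _) (@meetr _ _ _ _).
  exact: entails_trans (@meetr _ _ _ _) (@meetl _ _ _ _).
Qed.

(** It suffices to treat the generic closed predicate, the inclusion of [Omega_closed j]: every
    closed predicate is a pullback of it. *)
Lemma dneg_of_boolean j (u : hom one (Omega : E)) :
  closed j u ->
  (forall (W : E) (p : hom W Omega), closed j p -> entails (u ∘ bang W) p) ->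
  boolean (sh j) -> lop_le (dneg_operator u) j.
Proof.
move=> cu ubot bool.
have stable : entails (neg u (neg u (Omega_closed_arr j))) (Omega_closed_arr j).
  pose X : sh j := exist _ _ (@sheaf_Omega_closed j).
  have [_ [tr [mt [jn [top [bot [cpl [topP [botP [mtP [jnP [dist [mc jc]]]]]]]]]]]]] := bool X.
  have rf A : @sub_le (sh j) X A A by apply/sub_leE/entails_refl.
  have ca : closed j (Omega_closed_arr j) := @closed_Omega_closed_arr j.
  pose A : subobject X := @pred_sub j X _ ca.
  pose D : subobject X := @pred_sub j X _ (closed_neg (neg u (Omega_closed_arr j)) cu).
  suff : sub_le D A by move=> /sub_leE; rewrite !sub_pred_sub.
  (* Excluded middle splits the double negation [D] of [A] into its meets with [A] and with the
     complement of [A]; the second meet turns out to be contradictory. *)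
  have DD : sub_le D (mt D (jn A (cpl A))).
    by apply/mtP; split=> //; apply: (tr _ _ _ (topP D) (proj2 (jc A))).
  apply: (tr _ _ _ DD); apply: (tr _ _ _ (proj1 (dist _ _ _))); apply/jnP.
  split; first by have /mtP [] := rf (mt D A).
  have /mtP [/sub_leE mD /sub_leE mC] := rf (mt D (cpl A)).
  (* The abstract complement meets [A] in the bottom, hence below [u], so it lies below the relative
     negation. *)
  have Cn : entails (sub_pred (cpl A)) (neg u (Omega_closed_arr j)).
    pose U : subobject X := @pred_sub j X _ (closed_comp (bang _) cu).
    pose M : subobject X :=
      @pred_sub j X _ (closed_meet (closed_sub_pred (cpl A)) ca).
    have : sub_le M U.
      apply: (tr _ _ _ _ (tr _ _ _ (proj1 (mc A)) (botP U))).
      apply/mtP; split; apply/sub_leE; rewrite !sub_pred_sub;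
        [apply: meetr | apply: meetl].
    by move=> /sub_leE; rewrite !sub_pred_sub => /entails_neg.
  apply/sub_leE; rewrite sub_pred_sub; apply: entails_trans (ubot _ _ ca).
  apply: (neg_elim (p := neg u (Omega_closed_arr j))).
    by move: mD; rewrite sub_pred_sub.
  exact: entails_trans mC Cn.
move=> W p; rewrite dneg_operatorE.
have [w wE] := proj1 (Omega_closed_factor _ _) (lop_closed j p).
apply: (entails_trans (q := neg u (neg u (lop j ∘ p)))).
  by apply/neg_anti/neg_anti/lop_unit.
by have := entails_comp (x := w) stable; rewrite !neg_comp wE.
Qed.

(** Subobjects of the terminal sheaf correspond to closed truth values, with truth and [u] as the
    extremes. *)
Lemma two_valued_closed j (u : hom one (Omega : E)) :
  closed j u ->
  (forall (W : E) (p : hom W Omega), closed j p -> entails (u ∘ bang W) p) ->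
  two_valued (sh j) <->
  ~ holds u /\ (forall v, closed j v -> holds v \/ v = u).
Proof.
move=> cu ubot; split.
  move=> [T [Tter [U [V [nUV UV]]]]].
  have [a _] := Tter (exist _ one (@sheaf_one j)).
  have eqp (A B : subobject T) :
      ord_equiv (@sub_le _ T) A B <-> sub_pred A = sub_pred B.
    rewrite /ord_equiv !sub_leE; split=> [[AB BA]|->]; last by split.
    exact: entails_antisym.
  have {}UV (p : hom (proj1_sig T) Omega) : closed j p ->
      p = sub_pred U \/ p = sub_pred V.
    by move=> cp; have := UV (pred_sub cp); rewrite !eqp sub_pred_sub.
  move: nUV; rewrite eqp => nUV.
  (* The given terminal sheaf [T] need not be [one] itself; precomposing with its point [a] recovers
     global truth values from predicates on [T]. *)
  have back (v w : hom one (Omega : E)) :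
      v ∘ bang (proj1_sig T) = w ∘ bang (proj1_sig T) -> v = w.
    move=> /(f_equal (fun f => f ∘ (a : hom one (proj1_sig T)))).
    by rewrite !global_comp !global_one.
  have nu : ~ holds u.
    move=> hu; apply: nUV.
    have top (A : subobject T) : sub_pred A = truth ∘ bang _.
      apply: entails_holds (ubot _ _ (closed_sub_pred A)) _.
      by rewrite /holds hu global_one.
    by rewrite !top.
  split=> // v cv.
  have ct : closed j (truth : hom one (Omega : E)).
    by rewrite -[truth]global_one; apply: closed_true.
  have nut : u ∘ bang (proj1_sig T) <> truth ∘ bang (proj1_sig T).
    by move=> /back ut; apply: nu; rewrite /holds global_one.
  have hv : v ∘ bang (proj1_sig T) = truth ∘ bang (proj1_sig T) -> holds v.
    by move=> /back ->; rewrite /holds global_one.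
  (* Three predicates take only two values and those of [u] and truth differ, so that of [v] equals
     one of them. *)
  have := UV _ (closed_comp (bang _) cu).
  have := UV _ (closed_comp (bang _) ct).
  have := UV _ (closed_comp (bang _) cv).
  move=> [ev|ev] [et|et] [eu|eu];
    first [ by left; apply: hv; rewrite ev et
          | by right; apply: back; rewrite ev eu
          | by case: nut; rewrite et eu ].
move=> [nu two]; exists (exist _ one (@sheaf_one j)).
split; first exact: sheaf_one_terminal.
set T : sh j := exist _ _ _.
exists (@pred_sub j T _ (closed_true j one)), (@pred_sub j T _ cu); split.
  move=> [/sub_leE]; rewrite !sub_pred_sub => tu _; apply: nu.
  exact: entails_holds tu (@holds_true _ _).
move=> W; rewrite /ord_equiv !sub_leE !sub_pred_sub.
by have [->|->] := two _ (closed_sub_pred W); [left | right].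
Qed.

End Operators.

Theorem proposition10p1 (E : topos) (j : local_operator E) :
  is_atom j <-> two_valued (sh j) /\ boolean (sh j).
Proof.
have [bot botE] := falsity_exists E.
have least k (W : E) (p : hom W Omega) :
    closed k p -> entails (lop k ∘ bot ∘ bang W) p.
  by move=> cp; rewrite -comp_assoc; apply: closed_entails.
have cl k : closed k (lop k ∘ bot) by apply: lop_closed.
have bottom_trivial k : holds (lop k ∘ bot) -> trivial (sh k).
  move=> hk; apply/trivial_shE => W p.
  apply: entails_holds (least k W _ (lop_closed k p)) _.
  by rewrite hk global_one; apply: holds_true.
rewrite (two_valued_closed (cl j) (least j)); split.
  move=> at_j; have nu : ~ holds (lop j ∘ bot).
    by move=> /bottom_trivial; case: at_j.
  split; last first.
    by apply: (boolean_of_dneg (cl j) (least j)); apply: atom_dneg.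
  split=> // v cv; case: (classic (holds v)) => nv; [by left | right].
  (* [v] lies below every double negation relative to [v]; since [j] is an atom, that double
     negation of [lop j ∘ bot] lies below [lop j ∘ bot]. *)
  apply: entails_antisym.
    apply: (entails_trans (q := lop (dneg_operator v) ∘ (lop j ∘ bot))).
      rewrite dneg_operatorE; apply/entails_neg.
      by rewrite global_one; apply: meetl.
    by rewrite -{2}(cl j); apply: atom_dneg.
  by have := least j _ v cv; rewrite global_one.
move=> [[nu two] bool]; split.
  by move=> /trivial_shE h; apply: nu.
move=> [k [[/subtopos_leE jk nkj] ntk]].
(* The value [lop k ∘ bot] is [j]-closed. If it were true, [sh k] would be trivial, so it equals
   [lop j ∘ bot]. *)
have [//|ek] := two _ (closed_above jk (cl k)); first by move/bottom_trivial.
apply: nkj; apply/subtopos_leE => W p.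
have le : lop_le _ j := dneg_of_boolean (cl j) (least j) bool.
(* Double negation relative to this common value lies above [k] and, by Booleanness, below [j]; so
   [k] is below [j], against properness. *)
apply: (entails_trans _ (le W p)).
by rewrite -ek; apply: lop_le_dneg.
Qed.
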